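(* Let $(X,G)$ be a complete $G$-metric space with $|X|\geq 3$. Let $T: X\to X$ be a mapping satisfying the following conditions: (I) for all $x\in X$, $T(Tx)\neq x$ provided $Tx\neq x$; (II) there exists $\lambda\in \left(0,\frac{1}{3}\right)$ such that for all pairwise distinct points $x,y,z\in X$, $$G(Tx,Ty,Tz)\leq \lambda \left[G(x,Tx,Tx)+G(y,Ty,Ty)+G(z,Tz,Tz)\right].$$ Then $\operatorname{Fix}(T)\neq\emptyset$ and $|\operatorname{Fix}(T)|\leq 2$.
   Context: $X$ is a nonempty set, $|X|$ denotes its cardinality, and $\operatorname{Fix}(T)=\{x\in X: Tx=x\}$. Write $\mathbb{R}^+=[0,\infty)$. A mapping $G: X\times X\times X\to \mathbb{R}^+$ is a $G$-metric on $X$, and $(X,G)$ is a $G$-metric space, if for all $x,y,z,w\in X$: (P1) $G(x,y,z)=0$ if and only if $x=y=z$; (P2) if $x\neq y$, then $G(x,x,y)>0$; (P3) $G$ is invariant under every permutation of its three arguments; (P4) if $y\neq z$, then $G(x,x,y)\leq G(x,y,z)$; (P5) $G(x,y,z)\leq G(x,w,w)+G(w,y,z)$. A sequence $\{x_n\}$ in $X$ is $G$-convergent to $x\in X$ if $\lim_{n,m\to\infty}G(x_n,x_m,x)=0$. It is $G$-Cauchy if $\lim_{n,m\to\infty}G(x_n,x_m,x_m)=0$. $(X,G)$ is complete if every $G$-Cauchy sequence in $X$ is $G$-convergent to an element of $X$. *)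

(* Defs.v *)
From mathcomp Require Import all_boot all_order all_algebra.
From mathcomp Require Import all_classical all_reals all_analysis.
Import Order.TTheory GRing.Theory Num.Theory.
Import numFieldNormedType.Exports.

Set Implicit Arguments.
Unset Strict Implicit.
Unset Printing Implicit Defensive.

Local Open Scope classical_set_scope.
Local Open Scope ring_scope.

Record is_Gmetric (R : realType) (X : Type) (G : X -> X -> X -> R) : Prop := {
  Gmetric_ge0 : forall x y z, 0 <= G x y z ;
  Gmetric_eq0 : forall x y z, G x y z = 0 <-> (x = y /\ y = z) ;
  Gmetric_gt0 : forall x y, x <> y -> 0 < G x x y ;
  Gmetric_sym : forall x y z,
    [/\ G x y z = G x z y, G x y z = G y x z, G x y z = G y z x,
        G x y z = G z x y & G x y z = G z y x] ;
  Gmetric_le : forall x y z, y <> z -> G x x y <= G x y z ;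
  Gmetric_rect : forall x y z w, G x y z <= G x w w + G w y z
}.

(* The filter (\oo, \oo) on nat * nat expresses the joint limit in which both
   indices tend to infinity independently. *)
Definition Gcvg_to (R : realType) (X : Type) (G : X -> X -> X -> R)
    (u : nat -> X) (l : X) : Prop :=
  G (u p.1) (u p.2) l @[p --> (\oo, \oo)] --> (0 : R).

Definition Gcauchy (R : realType) (X : Type) (G : X -> X -> X -> R)
    (u : nat -> X) : Prop :=
  G (u p.1) (u p.2) (u p.2) @[p --> (\oo, \oo)] --> (0 : R).

Definition Gcomplete (R : realType) (X : Type) (G : X -> X -> X -> R) : Prop :=
  forall u : nat -> X, Gcauchy G u -> exists l : X, Gcvg_to G u l.

Definition Fix (X : Type) (T : X -> X) : set X := [set x | T x = x].

(* Main.v *)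
Require Import Defs.
From mathcomp Require Import all_boot all_order all_algebra.
From mathcomp Require Import all_classical all_reals all_analysis.
From mathcomp Require Import ring lra.
Import Order.TTheory GRing.Theory Num.Theory.
Import numFieldNormedType.Exports.

(** Write [d x = G x (T x) (T x)] for the displacement of [x], and suppose that
    [T] has no fixed point.  As [T] has no 2-cycle either, any three successive
    points of an orbit are pairwise distinct, so the contraction applies to them:
    [G (T x) (T (T x)) (T (T (T x)))] is at most [lambda] times the sum of three
    successive displacements.  By (P4) it is at least the displacement of
    [T (T x)], so that
      [d (T (T x)) <= lambda / (1 - lambda) * (d (T x) + d x)],
    where [lambda / (1 - lambda) < 1 / 2] because [lambda < 1 / 3].  Such a
    two-step recurrence becomes a one-step contraction for the energy
    [d (T x) + d x / 2] ([energy_contract]).  The energy thus decays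
    geometrically along an orbit; the sum of the displacements from the n-th
    point on is dominated by the n-th energy ([orbit_dist_le]), and the orbit is
    Cauchy ([orbit_Gcauchy]).

    Let [l] be its limit.  The energies along the orbit tend to [0] while the
    energy of [l] is positive, so the orbit eventually avoids [l], and the
    contraction applies to [l] and two successive points of the orbit.  Passing
    to the limit gives [d l <= lambda * d l], hence [d l = 0], a contradiction.

    Finally, the contraction applied to three distinct fixed points would make
    [G] vanish at them, against (P1); hence there are at most two. *)

Set Implicit Arguments.
Unset Strict Implicit.

Local Open Scope card_scope.
Local Open Scope classical_set_scope.
Local Open Scope ring_scope.

(** * Sets with at most two elements *)

Lemma card_le_image_nat (X : Type) (A : set X) (n : nat) (f : nat -> X) :
  A `<=` f @` `I_n -> A #<= `I_n.
Proof.
move=> Af; apply: card_le_trans (card_image_le f `I_n).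
exact: subset_card_le.
Qed.

Lemma card_le2_no_distinct3 (X : Type) (A : set X) (p : X) : A p ->
  (forall x y z, A x -> A y -> A z -> x <> y -> y <> z -> x <> z -> False) ->
  A #<= `I_2.
Proof.
move=> Ap no3.
have [q Aq] : exists q, forall z, A z -> z = p \/ z = q.
  have [[q [Aq qp]]|noq] := pselect (exists q, A q /\ q <> p).
    exists q => z Az; apply: contrapT => /not_orP[zp zq].
    by apply: (no3 p q z) => // [pq|qz|pz]; [apply: qp|apply: zq|apply: zp].
  exists p => z Az; left; apply: contrapT => zp; apply: noq.
  by exists z.
apply: (@card_le_image_nat _ _ _ (fun n => if n is 0%N then p else q)).
by move=> z /Aq[->|->]; [exists 0%N|exists 1%N].
Qed.

(** * G-metrics *)

Section Gmetric.
Context (R : realType) (X : Type) (G : X -> X -> X -> R).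
Hypothesis G_metric : is_Gmetric G.

Lemma Gmetric_xx0 x : G x x x = 0.
Proof. exact/(Gmetric_eq0 G_metric). Qed.

Lemma Gmetric_permC x y z : G x y z = G y z x.
Proof. by case: (Gmetric_sym G_metric x y z). Qed.

Lemma Gmetric_rev x y z : G x y z = G z y x.
Proof. by case: (Gmetric_sym G_metric x y z). Qed.

(** (P4) in the form that bounds displacements: the doubled point [y] may
    coincide with the point [z] that is dropped, only [x] must differ from it. *)
Lemma Gmetric_dist_le x y z : x <> z -> G x y y <= G y x z.
Proof. by move=> xz; rewrite Gmetric_permC; apply: (Gmetric_le G_metric). Qed.

(** [G x y y] is not symmetric in [x] and [y], but it is up to a factor 2. *)
Lemma Gmetric_dist_swap x y : G x y y <= 2 * G y x x.
Proof.
have := Gmetric_rect G_metric y y x x.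
rewrite (Gmetric_permC x y x) (Gmetric_permC x y y); lra.
Qed.

(** * Contraction along the orbits of a map without fixed points *)

Section Contraction.
Variables (T : X -> X) (lambda : R).
Hypotheses (lambda_gt0 : 0 < lambda) (lambda_lt : lambda < 3^-1).
Hypothesis T_contr : forall x y z : X, x <> y -> y <> z -> x <> z ->
  G (T x) (T y) (T z) <=
    lambda * (G x (T x) (T x) + G y (T y) (T y) + G z (T z) (T z)).

Definition displacement x : R := G x (T x) (T x).

(** Under the recurrence [d (T (T x)) <= b * (d (T x) + d x)], the energy of
    [T x] is at most [(b + 1 / 2) * d (T x) + b * d x].  With the weight [1 / 2]
    on [d x], this is at most [b + 1 / 2] times the energy of [x] exactly when
    [b <= (b + 1 / 2) / 2], that is, when [b <= 1 / 2]. *)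
Definition energy x : R := displacement (T x) + displacement x / 2.

Definition rate : R := lambda / (1 - lambda) + 2^-1.

Lemma displacement_ge0 x : 0 <= displacement x.
Proof. exact: (Gmetric_ge0 G_metric). Qed.

Lemma rate_bounds : 0 < rate < 1.
Proof.
rewrite /rate; have l1 : 0 < 1 - lambda by have := lambda_lt; lra.
have ? : 0 < lambda / (1 - lambda) by rewrite divr_gt0.
have ? : lambda / (1 - lambda) < 2^-1 by rewrite ltr_pdivrMr //; have := lambda_lt; lra.
by apply/andP; split; lra.
Qed.

Lemma no_three_fixed_points x y z : T x = x -> T y = y -> T z = z ->
  x <> y -> y <> z -> x <> z -> False.
Proof.
move=> Tx Ty Tz xy yz xz.
have := T_contr xy yz xz; rewrite Tx Ty Tz !Gmetric_xx0 !addr0 mulr0 => Gle0.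
have /(Gmetric_eq0 G_metric)[xy0 _] : G x y z = 0.
  by apply/eqP; rewrite eq_le Gle0 (Gmetric_ge0 G_metric).
exact: xy.
Qed.

Hypothesis T_no_fix : forall x, T x <> x.
Hypothesis T_no_2cycle : forall x, T (T x) <> x.

Lemma displacement_gt0 x : 0 < displacement x.
Proof.
rewrite /displacement Gmetric_permC.
by apply: (Gmetric_gt0 G_metric); apply: T_no_fix.
Qed.

Lemma energy_gt0 x : 0 < energy x.
Proof.
by rewrite /energy; have := displacement_gt0 x; have := displacement_gt0 (T x); lra.
Qed.

Lemma displacement_recurrence x :
  (1 - lambda) * displacement (T (T x)) <=
    lambda * (displacement (T x) + displacement x).
Proof.
have d_le : displacement (T (T x)) <= G (T x) (T (T x)) (T (T (T x))).
  by rewrite Gmetric_rev; apply: Gmetric_dist_le; apply: T_no_fix.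
have c_le : G (T x) (T (T x)) (T (T (T x))) <=
    lambda * (displacement x + displacement (T x) + displacement (T (T x))).
  by apply: T_contr => /esym; [apply: T_no_fix | apply: T_no_fix
    | apply: T_no_2cycle].
lra.
Qed.

Lemma energy_contract x : energy (T x) <= rate * energy x.
Proof.
have l1 : 0 < 1 - lambda by have := lambda_lt; lra.
have [_ rate_lt1] := andP rate_bounds.
have rec : displacement (T (T x)) <=
    lambda / (1 - lambda) * (displacement (T x) + displacement x).
  by rewrite mulrAC ler_pdivlMr // mulrC displacement_recurrence.
rewrite /energy; move: rate_lt1 rec; rewrite /rate.
have := displacement_ge0 x; move: (lambda / (1 - lambda)) => b.
nra.
Qed.

Lemma energy_iter n x : energy (iter n T x) <= rate ^+ n * energy x.
Proof.
have [rate_gt0 _] := andP rate_bounds.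
elim: n => [|n IHn]; first by rewrite expr0 mul1r.
rewrite iterS exprS -mulrA; apply: le_trans (energy_contract _) _.
by rewrite ler_pM2l.
Qed.

(** Since [energy (T y) <= rate * energy y], each displacement along the orbit
    is at most a fixed multiple of the drop of energy; the drops telescope. *)
Lemma orbit_dist_le k x :
  G x (iter k T x) (iter k T x) <=
    2 / (1 - rate) * (energy x - energy (iter k T x)).
Proof.
have [_ rate_lt1] := andP rate_bounds.
have C_gt0 : 0 < 1 - rate by lra.
elim: k => [|k IHk]; first by rewrite /= Gmetric_xx0 subrr mulr0.
rewrite iterS; set y := iter k T x in IHk *.
have step : displacement y <= 2 / (1 - rate) * (energy y - energy (T y)).
  rewrite mulrAC ler_pdivlMr //.
  have := energy_contract y; have := displacement_ge0 (T y).
  have : displacement y <= 2 * energy y.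
    by rewrite /energy; have := displacement_ge0 (T y); lra.
  nra.
have := Gmetric_rect G_metric x (T y) (T y) y.
rewrite -/(displacement y); lra.
Qed.

Lemma orbit_dist_geo n k x :
  G (iter n T x) (iter (n + k) T x) (iter (n + k) T x) <=
    2 / (1 - rate) * (rate ^+ n * energy x).
Proof.
have [_ rate_lt1] := andP rate_bounds.
rewrite addnC iterD; apply: le_trans (orbit_dist_le _ _) _.
have C_gt0 : 0 < 2 / (1 - rate) by rewrite divr_gt0 // subr_gt0.
rewrite ler_pM2l // lerBlDr; apply: le_trans (energy_iter n x) _.
by rewrite lerDl ltW // energy_gt0.
Qed.

Lemma rate_expr_cvg0 : rate ^+ n @[n --> \oo] --> (0 : R).
Proof.
apply: cvg_expr; have /andP[rate_gt0 rate_lt1] := rate_bounds.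
by rewrite gtr0_norm.
Qed.

Lemma orbit_energy_cvg0 x : energy (iter n T x) @[n --> \oo] --> (0 : R).
Proof.
apply: (@squeeze_cvgr _ _ _ _ (cst 0) (fun n => rate ^+ n * energy x)).
- by near=> n; apply/andP; split; [apply/ltW/energy_gt0|apply: energy_iter].
- exact: cvg_cst.
- by rewrite -[0](mul0r (energy x)); apply: cvgMl; apply: rate_expr_cvg0.
Unshelve. all: by end_near. Qed.

Lemma orbit_Gcauchy x : Gcauchy G (fun n => iter n T x).
Proof.
have /andP[rate_gt0 rate_lt1] := rate_bounds.
pose K := 2 * (2 / (1 - rate)) * energy x.
have C_gt0 : 0 < 2 / (1 - rate) by rewrite divr_gt0 // subr_gt0.
have K_gt0 : 0 < K by apply: mulr_gt0 (energy_gt0 x); apply: mulr_gt0.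
have bound n m : G (iter n T x) (iter m T x) (iter m T x) <=
    K * (rate ^+ n + rate ^+ m).
  have rn_gt0 i : 0 < K * rate ^+ i by rewrite mulr_gt0 // exprn_gt0.
  have KE i : 2 * (2 / (1 - rate) * (rate ^+ i * energy x)) = K * rate ^+ i.
    by rewrite /K; ring.
  have := rn_gt0 n; have := rn_gt0 m; have := KE n; have := KE m.
  case: (leqP n m) => [/subnKC <-|/ltnW /subnKC <-].
    by have := orbit_dist_geo n (m - n) x; lra.
  have := orbit_dist_geo m (n - m) x.
  have := Gmetric_dist_swap (iter (m + (n - m)) T x) (iter m T x); lra.
apply: (@squeeze_cvgr _ _ _ _ (cst 0)
         (fun p : nat * nat => K * (rate ^+ p.1 + rate ^+ p.2))).
- by near=> p; rewrite (Gmetric_ge0 G_metric) bound.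
- exact: cvg_cst.
- rewrite -[0](mulr0 K) -[X in K * X](addr0 0).
  apply: cvgMr; apply: cvgD.
    by apply: (cvg_comp _ _ cvg_fst rate_expr_cvg0).
  by apply: (cvg_comp _ _ cvg_snd rate_expr_cvg0).
Unshelve. all: by end_near. Qed.

Lemma Gcvg_to_diag (u : nat -> X) l :
  Gcvg_to G u l -> G l (u n) (u n) @[n --> \oo] --> (0 : R).
Proof.
move=> ul.
have diag : (n, n) @[n --> \oo] --> (\oo, \oo) by apply: cvg_pair; apply: cvg_id.
have := cvg_comp _ _ diag ul.
by under eq_fun do rewrite /= Gmetric_permC Gmetric_permC.
Qed.

(** The contraction at [x], [T x] and [l] bounds [G (T x) (T (T x)) (T l)];
    (P4) drops [T (T x)] from it, and (P5) moves [T x] to [l].  Along an orbit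
    that converges to [l], the right-hand side tends to [0]. *)
Lemma displacement_le_near x l : x <> l -> T x <> l ->
  (1 - lambda) * displacement l <=
    G l (T x) (T x) + 3 * lambda * energy x.
Proof.
move=> xl Txl.
have contr : G (T x) (T (T x)) (T l) <=
    lambda * (displacement x + displacement (T x) + displacement l).
  by apply: T_contr => // /esym; apply: T_no_fix.
have drop : G (T x) (T l) (T l) <= G (T x) (T (T x)) (T l).
  rewrite (Gmetric_permC (T x) (T (T x))) (Gmetric_permC (T (T x))).
  by apply: Gmetric_dist_le => /esym; apply: T_no_fix.
have := Gmetric_rect G_metric l (T l) (T l) (T x).
have e_ge : displacement x + displacement (T x) <= 3 * energy x.
  rewrite /energy; have := displacement_ge0 x; have := displacement_ge0 (T x); lra.
rewrite -/(displacement l); have := lambda_gt0; nra.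
Qed.

Lemma orbit_no_limit x l : ~ Gcvg_to G (fun n => iter n T x) l.
Proof.
move=> ul; pose e := (1 - lambda) * displacement l / 2.
have e_gt0 : 0 < e by rewrite /e divr_gt0 // mulr_gt0 ?displacement_gt0 //; have := lambda_lt; lra.
have energy_cvg := orbit_energy_cvg0 x.
have shift (v : nat -> R) : v n @[n --> \oo] --> (0 : R) ->
    v n.+1 @[n --> \oo] --> (0 : R) by rewrite -cvg_shiftS.
near \oo => n.
have small_energy : energy (iter n T x) < e.
  by near: n; apply: cvgr_lt energy_cvg _ e_gt0.
have small_dist : G l (T (iter n T x)) (T (iter n T x)) < e.
  near: n.
  exact: cvgr_lt (shift _ (Gcvg_to_diag ul)) _ e_gt0.
(* The energies tend to 0, so the orbit leaves [l], whose energy is positive. *)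
have n_neq : iter n T x <> l.
  suff : energy (iter n T x) < energy l by move=> + nl; rewrite nl ltxx.
  by near: n; apply: cvgr_lt energy_cvg _ (energy_gt0 l).
have Sn_neq : T (iter n T x) <> l.
  suff : energy (T (iter n T x)) < energy l by move=> + nl; rewrite nl ltxx.
  near: n; exact: cvgr_lt (shift _ energy_cvg) _ (energy_gt0 l).
have := displacement_le_near n_neq Sn_neq.
have eE : 2 * e = (1 - lambda) * displacement l by rewrite /e; field.
rewrite -eE; have := energy_gt0 (iter n T x).
have := lambda_gt0; have := lambda_lt; nra.
Unshelve. all: by end_near. Qed.

End Contraction.
End Gmetric.

(** * The fixed point theorem *)

Unset Implicit Arguments.
Set Strict Implicit.

Theorem theorem3p4 (R : realType) (X : Type) (G : X -> X -> X -> R)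
    (G_metric : is_Gmetric G) (G_complete : Gcomplete G)
    (card_X : `I_3 #<= [set: X]) (T : X -> X)
    (T_no_2cycle : forall x : X, T x <> x -> T (T x) <> x)
    (T_contr : exists lambda : R, 0 < lambda < 3^-1 /\
      forall x y z : X, x <> y -> y <> z -> x <> z ->
        G (T x) (T y) (T z) <=
          lambda * (G x (T x) (T x) + G y (T y) (T y) + G z (T z) (T z))) :
  Fix T !=set0 /\ Fix T #<= `I_2.
Proof.
have [lambda [/andP[lambda_gt0 lambda_lt] contr]] := T_contr.
have [x0 _] : [set: X] !=set0.
  apply/set0P/eqP => X0; move: card_X; rewrite X0 card_le0.
  by move=> /eqP I30; have : `I_3 0%N by []; rewrite I30.
have [p Tp] : Fix T !=set0.
  apply: contrapT => noFix.
  have T_no_fix x : T x <> x by move=> Tx; apply: noFix; exists x.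
  have T_no_cycle x : T (T x) <> x := T_no_2cycle x (T_no_fix x).
  have [l ul] := G_complete _ (orbit_Gcauchy G_metric lambda_gt0 lambda_lt contr
    T_no_fix T_no_cycle x0).
  exact: (orbit_no_limit G_metric lambda_gt0 lambda_lt contr
    T_no_fix T_no_cycle ul).
split; first by exists p.
apply: (card_le2_no_distinct3 Tp) => x y z.
exact: (no_three_fixed_points G_metric contr).
Qed.
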